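(* Let $\mathcal P$ be a (symmetric or plain) 2-unitary operad over the field $\Bbbk$. If $\operatorname{GKdim}(\mathcal P)<2$, then $\mathcal P\cong\mathcal{C}om$.
   Context: Fix a field $\Bbbk$; all operads are $\Bbbk$-linear. A plain (non-symmetric) operad $\mathcal P$ consists of vector spaces $\mathcal P(n)$, $n\ge0$, an identity $\mathbf 1\in\mathcal P(1)$, and multilinear, unital, associative compositions $\theta\circ(\theta_1,\dots,\theta_n)$. A symmetric operad has in addition right $\mathbb S_n$-actions on $\mathcal P(n)$ satisfying the usual equivariance. $\mathcal P$ is unitary if $\mathcal P(0)=\Bbbk\mathbf 1_0\cong\Bbbk$; 2-unitary if it is unitary and there is $\mathbf 1_2\in\mathcal P(2)$ with $\mathbf 1_2\circ(\mathbf 1_0,\mathbf 1)=\mathbf 1=\mathbf 1_2\circ(\mathbf 1,\mathbf 1_0)$. $\mathcal{C}om$ is the operad of unital commutative algebras ($\mathcal{C}om(n)=\Bbbk$ for all $n\ge0$), regarded as a plain operad when $\mathcal P$ is plain. $\operatorname{GKdim}\mathcal P=\limsup_{n\to\infty}\log_n\big(\sum_{i=0}^n\dim_\Bbbk\mathcal P(i)\big)$; when GKdimension is discussed, $\mathcal P$ is implicitly assumed locally finite ($\dim_\Bbbk\mathcal P(n)<\infty$ for all $n$). *)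

(* Defs.v *)
From HB Require Import structures.
From mathcomp Require Import all_boot all_order all_algebra all_fingroup.
From mathcomp Require Import all_classical all_reals all_analysis.

Set Implicit Arguments.
Unset Strict Implicit.
Unset Printing Implicit Defensive.
Import Order.TTheory GRing.Theory Num.Theory.
Local Open Scope ring_scope.

(* Equality of operations whose arities agree only propositionally, such as
   \sum_(i < n) 1 and n.  Since equality on nat is proof irrelevant, this says
   that m = n and that transporting x along m = n gives y. *)
Definition op_eq (K : fieldType) (P : nat -> lmodType K) (m n : nat)
    (x : P m) (y : P n) : Prop :=
  existT (fun r => P r : Type) m x = existT (fun r => P r : Type) n y.

(* The inputs of theta o (theta_1, ..., theta_n) are the positions of
   'I_(\sum_i k i), enumerated block after block: position p is the input
   number tagnat.sig2 p of theta_(tagnat.sig1 p). *)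
Record plain_operad (K : fieldType) (P : nat -> lmodType K) := PlainOperad {
  op_id : P 1%N;
  op_comp : forall (n : nat) (k : 'I_n -> nat),
    P n -> (forall i, P (k i)) -> P (\sum_i k i)%N;
  op_comp_linearl : forall (n : nat) (k : 'I_n -> nat) (phi : forall i, P (k i)),
    linear (fun theta : P n => op_comp theta phi);
  op_comp_linearr : forall (n : nat) (k : 'I_n -> nat) (theta : P n)
      (phi : forall i, P (k i)) (i : 'I_n),
    linear (fun x : P (k i) => op_comp theta (eqtype.dfwith phi x));
  op_comp1l : forall (n : nat) (theta : P n),
    op_eq (op_comp (k := fun _ : 'I_1 => n) op_id (fun _ => theta)) theta;
  op_comp1r : forall (n : nat) (theta : P n),
    op_eq (op_comp (k := fun _ : 'I_n => 1%N) theta (fun _ => op_id)) theta;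
  op_compA : forall (n : nat) (k : 'I_n -> nat) (l : forall i, 'I_(k i) -> nat)
      (theta : P n) (phi : forall i, P (k i))
      (psi : forall i (j : 'I_(k i)), P (l i j)),
    op_eq
      (op_comp theta (fun i => op_comp (phi i) (psi i)))
      (op_comp (op_comp theta phi)
         (fun p => psi (tagnat.sig1 p) (tagnat.sig2 p))) }.

Lemma sum_perm_inv (n : nat) (k : 'I_n -> nat) (s : 'S_n) :
  (\sum_i k (s^-1%g i) = \sum_i k i)%N.
Proof. by rewrite [RHS](reindex_inj (@perm_inj _ s^-1%g)). Qed.

(* The permutation moving the block number a of the decomposition k_1 + ... +
   k_n to the block number s a of k_(s^-1 1) + ... + k_(s^-1 n), the order
   inside each block being kept. *)
Definition block_perm_fun (n : nat) (k : 'I_n -> nat) (s : 'S_n)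
    (p : 'I_(\sum_i k (s^-1%g i))%N) : 'I_(\sum_i k (s^-1%g i))%N :=
  let q := cast_ord (sum_perm_inv k s) p in
  @tagnat.Rank n (fun i => k (s^-1%g i)) (s (tagnat.sig1 q))
    (cast_ord (congr1 k (esym (permK s (tagnat.sig1 q)))) (tagnat.sig2 q)).

Lemma block_perm_fun_inj (n : nat) (k : 'I_n -> nat) (s : 'S_n) :
  injective (@block_perm_fun n k s).
Proof.
move=> p p' /(congr1 val) /eqP; rewrite tagnat.eq_Rank => /andP[/eqP/perm_inj e1 /=].
move=> e2; apply/(@cast_ord_inj _ _ (sum_perm_inv k s))/val_inj/eqP.
by rewrite -[X in val X]tagnat.sig2K -[X in _ == val X]tagnat.sig2K
  tagnat.eq_Rank; apply/andP; split; [rewrite e1 | exact: e2].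
Qed.

Definition block_perm (n : nat) (k : 'I_n -> nat) (s : 'S_n) :
  'S_(\sum_i k (s^-1%g i))%N := perm (@block_perm_fun_inj n k s).

Definition sum_perm_fun (n : nat) (k : 'I_n -> nat) (s : forall i, 'S_(k i))
    (p : 'I_(\sum_i k i)%N) : 'I_(\sum_i k i)%N :=
  tagnat.Rank (tagnat.sig1 p) (s (tagnat.sig1 p) (tagnat.sig2 p)).

Lemma sum_perm_fun_inj (n : nat) (k : 'I_n -> nat) (s : forall i, 'S_(k i)) :
  injective (sum_perm_fun s).
Proof.
move=> p p' /(congr1 (@tagnat.sig n k)).
rewrite /sum_perm_fun /tagnat.Rank !tagnat.rankK => e.
apply: tagnat.sig_inj; move: e; rewrite !tagnat.sigE12.
move: (tagnat.sig1 p) (tagnat.sig2 p) (tagnat.sig1 p') (tagnat.sig2 p').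
move=> a b a' b' e; have e1 : a = a' := congr1 tag e.
by case: _ / e1 b' e => b' /eqP; rewrite eq_Tagged => /eqP/perm_inj ->.
Qed.

Definition sum_perm (n : nat) (k : 'I_n -> nat) (s : forall i, 'S_(k i)) :
  'S_(\sum_i k i)%N := perm (@sum_perm_fun_inj n k s).

(* The product t * s of 'S_n maps i to s (t i), so op_actM is the axiom
   (theta . s) . t = theta . (s \o t) of a right action of the group of
   permutations under composition of functions.  On multilinear maps it is
   (theta . s)(x_1, ..., x_n) = theta (x_(s^-1 1), ..., x_(s^-1 n)). *)
Record sym_operad (K : fieldType) (P : nat -> lmodType K) := SymOperad {
  sym_plain :> plain_operad P;
  op_act : forall n, P n -> 'S_n -> P n;
  op_act_linear : forall n (s : 'S_n), linear (fun theta : P n => op_act theta s);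
  op_act1 : forall n (theta : P n), op_act theta 1%g = theta;
  op_actM : forall n (theta : P n) (s t : 'S_n),
    op_act (op_act theta s) t = op_act theta (t * s)%g;
  op_act_comp : forall n (k : 'I_n -> nat) (theta : P n)
      (phi : forall i, P (k i)) (s : 'S_n),
    op_eq
      (op_comp sym_plain (op_act theta s) phi)
      (op_act (op_comp sym_plain theta (fun i => phi (s^-1%g i)))
         (block_perm k s));
  op_comp_act : forall n (k : 'I_n -> nat) (theta : P n)
      (phi : forall i, P (k i)) (s : forall i, 'S_(k i)),
    op_comp sym_plain theta (fun i => op_act (phi i) (s i)) =
    op_act (op_comp sym_plain theta phi) (sum_perm s) }.

Definition plain_operad_iso (K : fieldType) (P Q : nat -> lmodType K)
    (A : plain_operad P) (B : plain_operad Q)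
    (f : forall n, {linear P n -> Q n}) : Prop :=
  [/\ forall n, bijective (f n),
      f 1%N (op_id A) = op_id B &
      forall n (k : 'I_n -> nat) (theta : P n) (phi : forall i, P (k i)),
        f _ (op_comp A theta phi) =
        op_comp B (f n theta) (fun i => f (k i) (phi i))].

Definition plain_isomorphic (K : fieldType) (P Q : nat -> lmodType K)
    (A : plain_operad P) (B : plain_operad Q) : Prop :=
  exists f, plain_operad_iso A B f.

Definition sym_isomorphic (K : fieldType) (P Q : nat -> lmodType K)
    (A : sym_operad P) (B : sym_operad Q) : Prop :=
  exists2 f, plain_operad_iso A B f &
    forall n (theta : P n) (s : 'S_n),
      f n (op_act A theta s) = op_act B (f n theta) s.

Definition arity2 (m n : nat) (i : 'I_2) : nat :=
  if nat_of_ord i is 0 then m else n.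

Definition op_pair (K : fieldType) (P : nat -> lmodType K) (m n : nat)
    (x : P m) (y : P n) (i : 'I_2) : P (arity2 m n i) :=
  match nat_of_ord i as v return P (if v is 0 then m else n) with
  | 0 => x
  | _.+1 => y
  end.

Definition spans_arity0 (K : fieldType) (P : nat -> lmodType K) (u0 : P 0%N) :=
  u0 != 0 /\ forall x : P 0%N, exists a : K, x = a *: u0.

Definition two_unitary (K : fieldType) (P : nat -> lmodType K)
    (A : plain_operad P) : Prop :=
  exists u0 : P 0%N, spans_arity0 u0 /\
  exists u2 : P 2%N,
    op_eq (op_comp A u2 (op_pair u0 (op_id A))) (op_id A) /\
    op_eq (op_comp A u2 (op_pair (op_id A) u0)) (op_id A).

Section Com.
Variable K : fieldType.

Definition com_space (n : nat) : lmodType K := K^o.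

Definition com_comp (n : nat) (k : 'I_n -> nat) (theta : com_space n)
    (phi : forall i, com_space (k i)) : com_space (\sum_i k i)%N :=
  (theta : K) * \prod_i (phi i : K).

Lemma com_op_eq (m n : nat) (x : com_space m) (y : com_space n) :
  m = n -> x = y :> K -> op_eq x y.
Proof. by move=> e; case: _ / e y => y ->. Qed.

Lemma com_comp_linearl (n : nat) (k : 'I_n -> nat)
    (phi : forall i, com_space (k i)) :
  linear (fun theta : com_space n => com_comp theta phi).
Proof. by move=> a x y; rewrite /com_comp mulrDl /GRing.scale /= mulrA. Qed.

Lemma com_comp_linearr (n : nat) (k : 'I_n -> nat) (theta : com_space n)
    (phi : forall i, com_space (k i)) (i : 'I_n) :
  linear (fun x : com_space (k i) => com_comp theta (eqtype.dfwith phi x)).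
Proof.
move=> a x y; rewrite /com_comp.
have E (z : com_space (k i)) : \prod_j (eqtype.dfwith phi z j : K) =
    (z : K) * \prod_(j | j != i) (phi j : K).
  rewrite (bigD1 i) //= eqtype.dfwith_in; congr (_ * _).
  by apply: eq_bigr => j ji; rewrite eqtype.dfwith_out // eq_sym.
by rewrite !E mulrDl mulrDr /GRing.scale /= -mulrA [LHS]/= (mulrCA theta).
Qed.

Lemma com_comp1l (n : nat) (theta : com_space n) :
  op_eq (com_comp (k := fun _ : 'I_1 => n) (1 : K) (fun _ => theta)) theta.
Proof. by apply: com_op_eq; rewrite ?/com_comp big_ord1 ?mul1r. Qed.

Lemma com_comp1r (n : nat) (theta : com_space n) :
  op_eq (com_comp (k := fun _ : 'I_n => 1%N) theta (fun _ => (1 : K))) theta.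
Proof.
apply: com_op_eq; first by rewrite sum1_card card_ord.
by rewrite /com_comp big1 ?mulr1.
Qed.

Lemma com_compA (n : nat) (k : 'I_n -> nat) (l : forall i, 'I_(k i) -> nat)
    (theta : com_space n) (phi : forall i, com_space (k i))
    (psi : forall i (j : 'I_(k i)), com_space (l i j)) :
  op_eq
    (com_comp theta (fun i => com_comp (phi i) (psi i)))
    (com_comp (com_comp theta phi)
       (fun p => psi (tagnat.sig1 p) (tagnat.sig2 p))).
Proof.
apply: com_op_eq.
  rewrite sig_big_dep /= (reindex _ (@tagnat.sig_bij_on n k)) /=.
  exact: eq_bigr.
rewrite /com_comp -mulrA -[X in _ = _ * (_ * X)]/(\prod_p (psi _ _ : K)).
rewrite big_split /=; congr (_ * (_ * _)).
rewrite sig_big_dep /= (reindex _ (@tagnat.sig_bij_on n k)) /=.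
exact: eq_bigr.
Qed.

Definition Com : plain_operad com_space :=
  PlainOperad com_comp_linearl com_comp_linearr com_comp1l com_comp1r com_compA.

Lemma com_act_comp (n : nat) (k : 'I_n -> nat) (theta : com_space n)
    (phi : forall i, com_space (k i)) (s : 'S_n) :
  op_eq (com_comp theta phi) (com_comp theta (fun i => phi (s^-1%g i))).
Proof.
apply: com_op_eq; first by rewrite sum_perm_inv.
by rewrite /com_comp [X in _ * X](reindex_inj (@perm_inj _ s^-1%g)).
Qed.

Definition symCom : sym_operad com_space :=
  @SymOperad K com_space Com (fun n theta _ => theta)
    (fun n _ _ _ _ => erefl) (fun n _ => erefl) (fun n _ _ _ => erefl)
    com_act_comp (fun n _ _ _ _ => erefl).

End Com.

Definition lmod_of (K : fieldType) (P : nat -> vectType K) (n : nat) :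
  lmodType K := P n.

(* Local finiteness is carried by the type of P: a vectType is a
   finite-dimensional vector space.  The terms n = 0, 1, for which log_n is
   undefined, do not affect the limsup. *)
Definition GKdim (R : realType) (K : fieldType) (P : nat -> vectType K) :
    \bar R :=
  limn_esup (fun n : nat =>
    (ln (\sum_(i < n.+1) \dim {:P i})%N%:R / ln n%:R)%:E).

(* Main.v *)
Require Import Defs.
From HB Require Import structures.
From mathcomp Require Import all_boot all_order all_algebra all_fingroup.
From mathcomp Require Import all_classical all_reals all_analysis.
From mathcomp Require Import zify lra.

Set Implicit Arguments.
Unset Strict Implicit.
Unset Printing Implicit Defensive.
Import Order.TTheory GRing.Theory Num.Theory.
Local Open Scope ring_scope.

(** Plugging the unit u0 of P(0) into the first input of an operation gives
    linear maps del_first : P(n+1) -> P(n).  Each of them is a split surjection,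
    with section x |-> u2(id, x), because u2(u0, id) = id.  There are two cases.

    If all the maps del_first are injective, plugging u0 into every input embeds
    P(n) into P(0) = K u0.  The resulting scalar aug x, defined by
    x(u0, ..., u0) = aug x *: u0, is linear in x, compatible with composition by
    associativity and multilinearity (aug_comp), and invariant under
    permutations, since there is only one permutation of no inputs (aug_act).
    It is not zero in any arity, so it is an isomorphism onto Com (aug_iso).

    Otherwise some nonzero x in P(k+1) is killed by del_first.  The map
    y |-> u2(y, id) commutes with del_first, and it is injective since plugging
    u0 into the last input undoes it.  Its iterates carry x to nonzero elements
    of the kernel of del_first in all arities greater than k.  Hence
    dim P(n+1) > dim P(n) for all n >= k (dim_growth): the dimensions grow at
    least linearly, their partial sums at least quadratically, and the
    Gelfand-Kirillov dimension is at least 2.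

    Arities of composites agree only propositionally, so equations between
    composites are proved in the total space of operations of all arities.
    There a composite is taken along a sequence of operations, and
    associativity says that nested composition is composition along the
    concatenated sequence (scompA). *)

(** * Composition along sequences *)

(** The position of the c-th entry of block r, in the form given by
    tagnat.rect, which numbers the inputs of a composite block after block. *)
Lemma nth_flatten_block (T : Type) (x0 : T) (ss : seq (seq T)) (r c : nat) :
  (r < size ss)%N -> (c < size (nth [::] ss r))%N ->
  nth x0 (flatten ss) (\sum_(i < r) size (nth [::] ss i) + c)%N =
  nth x0 (nth [::] ss r) c.
Proof.
elim: ss r => [|s ss IH] [|r] //= rs cs.
  by rewrite big_ord0 nth_cat cs.
rewrite big_ord_recl /= -addnA nth_cat ltnNge leq_addr /= addKn.
exact: IH.
Qed.

Section Operad.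
Variables (K : fieldType) (P : nat -> lmodType K) (A : plain_operad P).

Definition operation : Type := {n : nat & P n : Type}.

Definition op n (x : P n) : operation := existT (fun r => P r : Type) n x.

Definition idop : operation := op (op_id A).

(** The inputs are packed with their arities, so that changing one of them is
    an equality of functions into a fixed type, with no transport. *)
Definition fcomp n (theta : P n) (F : 'I_n -> operation) : operation :=
  op (op_comp A theta (fun i => tagged (F i))).

(** Meaningful when the size of s is the arity of x; the default idop is never
    reached in that case. *)
Definition scomp (x : operation) (s : seq operation) : operation :=
  fcomp (tagged x) (fun i => nth idop s i).

Lemma op_inj n : injective (@op n).
Proof. by move=> x y; apply: (@eq_from_Tagged nat (fun r => P r : Type)). Qed.

Lemma opE x : op (tagged x) = x. Proof. by case: x. Qed.

Lemma eq_fcomp n (theta : P n) F G : F =1 G -> fcomp theta F = fcomp theta G.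
Proof. by move=> /funext ->. Qed.

Lemma fcompA n (theta : P n) (F : 'I_n -> operation)
    (G : nat -> nat -> operation) :
  fcomp theta (fun i => fcomp (tagged (F i)) (fun j => G i j)) =
  fcomp (op_comp A theta (fun i => tagged (F i)))
     (fun p => G (tagnat.sig1 p) (tagnat.sig2 p)).
Proof.
exact: (@op_compA _ _ A n (fun i => tag (F i)) (fun i j => tag (G i j)) theta
  (fun i => tagged (F i)) (fun i j => tagged (G i j))).
Qed.

(** Associativity of the operad in unindexed form: the sequence ps lists the
    operations plugged into x, each with the sequence plugged into it. *)
Lemma scompA x (ps : seq (operation * seq operation)) :
  size ps = tag x -> all (fun p => size p.2 == tag p.1) ps ->
  scomp (scomp x (unzip1 ps)) (flatten (unzip2 ps)) =
  scomp x [seq scomp p.1 p.2 | p <- ps].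
Proof.
case: x => n theta /= sp /(all_nthP (idop, [::])) ok.
rewrite [RHS]/scomp /=.
transitivity (fcomp theta (fun i : 'I_n =>
    fcomp (tagged (nth idop (unzip1 ps) i))
          (fun j => nth idop (nth [::] (unzip2 ps) i) j))); last first.
  apply: eq_fcomp => i.
  have ip : (i < size ps)%N by rewrite sp.
  by rewrite !(nth_map (idop, [::])).
rewrite (fcompA theta (fun i => nth idop (unzip1 ps) i)
  (fun i j => nth idop (nth [::] (unzip2 ps) i) j)).
apply: eq_fcomp => p /=.
have szE (i : nat) : (i < n)%N ->
    size (nth [::] (unzip2 ps) i) = tag (nth idop (unzip1 ps) i).
  move=> lt_in; have ip : (i < size ps)%N by rewrite sp.
  by rewrite !(nth_map (idop, [::])) //; apply/eqP/ok.
rewrite -nth_flatten_block ?size_map ?sp ?szE //; congr nth.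
rewrite [LHS]tagnat.rect; congr (_ + _)%N.
set r := tagnat.sig1 _.
rewrite [RHS](big_ord_widen n (fun i => size (nth [::] (unzip2 ps) i))
  (ltnW (ltn_ord r))).
by apply: eq_bigr => i _; rewrite szE.
Qed.

Lemma scomp_id x : scomp idop [:: x] = x.
Proof.
transitivity (fcomp (op_id A) (fun=> x)).
  by apply: eq_fcomp => i; rewrite ord1.
by rewrite -[RHS]opE; exact: op_comp1l.
Qed.

Lemma scomp_ids x : scomp x (nseq (tag x) idop) = x.
Proof.
transitivity (fcomp (tagged x) (fun=> idop)).
  by apply: eq_fcomp => i; rewrite nth_nseq if_same.
by rewrite -[RHS]opE; exact: op_comp1r.
Qed.

(** * Multilinearity in all inputs at once *)

Lemma op_comp_eq0 n (k : 'I_n -> nat) (theta : P n)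
    (phi : forall i, P (k i)) i :
  phi i = 0 -> op_comp A theta phi = 0.
Proof.
move=> phi0; have -> : phi = eqtype.dfwith phi (0 : P (k i)).
  apply: functional_extensionality_dep => j.
  case: (eqVneq i j) => [<-|ij]; first by rewrite eqtype.dfwith_in.
  by rewrite eqtype.dfwith_out.
have := @op_comp_linearr _ _ A _ _ theta phi i (-1) 0 0.
by rewrite scaler0 addr0 scaleN1r addNr.
Qed.

Lemma op_comp_scale n (k : 'I_n -> nat) (theta : P n) (phi : forall i, P (k i))
    (c : 'I_n -> K) :
  op_comp A theta (fun i => c i *: phi i) =
  (\prod_i c i) *: op_comp A theta phi.
Proof.
have scale1 (psi : forall i, P (k i)) i a :
    op_comp A theta (eqtype.dfwith psi (a *: psi i)) = a *: op_comp A theta psi.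
  have := @op_comp_linearr _ _ A _ _ theta psi i a (psi i) 0.
  rewrite addr0 (@op_comp_eq0 _ _ _ (eqtype.dfwith psi (0 : P (k i))) i);
    last by rewrite eqtype.dfwith_in.
  rewrite addr0 => ->.
  congr (_ *: op_comp _ _ _); apply: functional_extensionality_dep => j.
  case: (eqVneq i j) => [<-|ij]; first by rewrite eqtype.dfwith_in.
  by rewrite eqtype.dfwith_out.
(* Multilinearity is used one input at a time, along a list of inputs. *)
have scale_seq (r : seq 'I_n) : uniq r ->
    op_comp A theta (fun i => (if i \in r then c i else 1) *: phi i) =
    (\prod_(i <- r) c i) *: op_comp A theta phi.
  elim: r => [_|i r IH /= /andP[ir ur]].
    rewrite big_nil scale1r; congr op_comp.
    by apply: functional_extensionality_dep => i; rewrite scale1r.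
  rewrite big_cons -scalerA -IH // -(scale1 _ i); congr op_comp.
  apply: functional_extensionality_dep => j; rewrite inE.
  case: (eqVneq i j) => [<-|ij].
    by rewrite eqtype.dfwith_in (negbTE ir) scale1r.
  by rewrite eqtype.dfwith_out.
rewrite -(big_enum _ _ _ c) -scale_seq ?enum_uniq //; congr op_comp.
by apply: functional_extensionality_dep => i; rewrite mem_enum.
Qed.

(** * Deleting and adding inputs in a 2-unitary operad *)

Definition cast_op m n (e : m = n) (x : P m) : P n := ecast r (P r) e x.

Lemma op_cast m n (e : m = n) (x : P m) : op (cast_op e x) = op x.
Proof. by case: _ / e. Qed.

Lemma cast_op_linear m n (e : m = n) : linear (cast_op e).
Proof. by case: _ / e. Qed.

Section TwoUnitary.
Variables (u0 : P 0%N) (u2 : P 2%N).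
Hypotheses (unitl : scomp (op u2) [:: op u0; idop] = idop).
Hypotheses (unitr : scomp (op u2) [:: idop; op u0] = idop).

Definition del_first_inputs n := op u0 :: nseq n idop.
Definition del_last_inputs n := rcons (nseq n idop) (op u0).

Lemma sum_nth_inputs (n m : nat) (s : seq operation) :
  size s = n -> sumn (map tag s) = m -> (\sum_(i < n) tag (nth idop s i))%N = m.
Proof.
move=> <- <-; rewrite sumnE big_map (big_nth idop) big_mkord.
exact: eq_bigr.
Qed.

Lemma del_first_arity n :
  (\sum_(i < n.+1) tag (nth idop (del_first_inputs n) i))%N = n.
Proof.
by apply: sum_nth_inputs; rewrite /= ?size_nseq // map_nseq sumn_nseq mul1n.
Qed.

Lemma del_last_arity n :
  (\sum_(i < n.+1) tag (nth idop (del_last_inputs n) i))%N = n.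
Proof.
apply: sum_nth_inputs; rewrite ?size_rcons ?size_nseq // map_rcons map_nseq.
by rewrite sumn_rcons sumn_nseq mul1n addn0.
Qed.

Definition del_first n (x : P n.+1) : P n :=
  cast_op (del_first_arity n)
    (op_comp A x (fun i => tagged (nth idop (del_first_inputs n) i))).

Definition del_last n (x : P n.+1) : P n :=
  cast_op (del_last_arity n)
    (op_comp A x (fun i => tagged (nth idop (del_last_inputs n) i))).

Lemma op_del_first n (x : P n.+1) :
  op (del_first x) = scomp (op x) (del_first_inputs n).
Proof. exact: op_cast. Qed.

Lemma op_del_last n (x : P n.+1) :
  op (del_last x) = scomp (op x) (del_last_inputs n).
Proof. exact: op_cast. Qed.

Lemma del_first_linear n : linear (@del_first n).
Proof.
by move=> a x y; rewrite /del_first op_comp_linearl cast_op_linear.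
Qed.

Lemma del_last_linear n : linear (@del_last n).
Proof.
by move=> a x y; rewrite /del_last op_comp_linearl cast_op_linear.
Qed.

HB.instance Definition _ n :=
  GRing.isLinear.Build K _ _ _ _ (@del_first_linear n).
HB.instance Definition _ n :=
  GRing.isLinear.Build K _ _ _ _ (@del_last_linear n).

Lemma pair_arity m n (x : P m) (y : P n) :
  (\sum_(i < 2) tag (nth idop [:: op x; op y] i))%N = (m + n)%N.
Proof. by rewrite big_ord_recl big_ord1. Qed.

Definition add_first n (x : P n) : P n.+1 :=
  cast_op (pair_arity (op_id A) x)
    (op_comp A u2 (fun i => tagged (nth idop [:: idop; op x] i))).

Definition add_last n (x : P n) : P n.+1 :=
  cast_op (etrans (pair_arity x (op_id A)) (addn1 n))
    (op_comp A u2 (fun i => tagged (nth idop [:: op x; idop] i))).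

Lemma op_add_first n (x : P n) :
  op (add_first x) = scomp (op u2) [:: idop; op x].
Proof. exact: op_cast. Qed.

Lemma op_add_last n (x : P n) :
  op (add_last x) = scomp (op u2) [:: op x; idop].
Proof. exact: op_cast. Qed.

Lemma add_last0 n : add_last (0 : P n) = 0.
Proof.
rewrite /add_last (@op_comp_eq0 _ _ _ _ ord0) //.
by case: _ / (etrans _ _).
Qed.

Lemma scomp_u2A x y s t : size s = tag x -> size t = tag y ->
  scomp (scomp (op u2) [:: x; y]) (s ++ t) =
  scomp (op u2) [:: scomp x s; scomp y t].
Proof.
move=> sx ty; have := @scompA (op u2) [:: (x, s); (y, t)] erefl.
by rewrite /= cats0 sx ty !eqxx; apply.
Qed.

Lemma scomp_u0 : scomp (op u0) [::] = op u0.
Proof. exact: (scomp_ids (op u0)). Qed.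

(** The axiom u2(u0, id) = id extends from id to every operation x: write u0 as
    u0() and x as id(x), then use associativity. *)
Lemma scomp_u2_u0l x : scomp (op u2) [:: op u0; x] = x.
Proof.
by rewrite -{1}scomp_u0 -{1}(scomp_id x) -scomp_u2A // unitl /= scomp_id.
Qed.

Lemma scomp_u2_u0r x : scomp (op u2) [:: x; op u0] = x.
Proof.
by rewrite -{1}scomp_u0 -{1}(scomp_id x) -scomp_u2A // unitr /= scomp_id.
Qed.

Lemma add_firstK n : cancel (@add_first n) (@del_first n).
Proof.
move=> x; apply: op_inj; rewrite op_del_first op_add_first.
rewrite -[del_first_inputs _]/([:: op u0] ++ nseq n idop).
rewrite scomp_u2A ?size_nseq //.
by rewrite scomp_id (scomp_ids (op x)) scomp_u2_u0l.
Qed.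

Lemma add_lastK n : cancel (@add_last n) (@del_last n).
Proof.
move=> x; apply: op_inj; rewrite op_del_last op_add_last.
rewrite /del_last_inputs -cats1 scomp_u2A ?size_nseq //.
by rewrite scomp_id (scomp_ids (op x)) scomp_u2_u0r.
Qed.

(** An operation of positive arity keeps its first input when a last one is
    added, so that the two constructions act on different inputs. *)
Lemma del_first_add_last n (x : P n.+1) :
  del_first (add_last x) = add_last (del_first x).
Proof.
apply: op_inj; rewrite op_del_first !op_add_last.
have -> : del_first_inputs n.+1 = del_first_inputs n ++ [:: idop].
  by rewrite /del_first_inputs cat_cons -[n.+1]addn1 nseqD.
rewrite scomp_u2A /= ?size_nseq // scomp_id op_del_first.
by [].
Qed.

(** * The augmentation *)

Section Augmentation.
Hypothesis span0 : spans_arity0 u0.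

Definition scalar0 (x : P 0%N) : K := projT1 (cid (span0.2 x)).

Lemma scalar0E x : x = scalar0 x *: u0.
Proof. by rewrite /scalar0; case: cid. Qed.

Lemma scalar0Z c : scalar0 (c *: u0) = c.
Proof.
apply/eqP; have /eqP := scalar0E (c *: u0).
by rewrite -subr_eq0 -scalerBl scaler_eq0 (negbTE span0.1) orbF subr_eq0 eq_sym.
Qed.

Lemma aug_arity n : (\sum_(i < n) tag (op u0))%N = 0%N.
Proof. by rewrite big1. Qed.

Definition aug_op n (x : P n) : P 0%N :=
  cast_op (aug_arity n) (op_comp A x (fun=> u0)).

Lemma op_aug_op n (x : P n) : op (aug_op x) = scomp (op x) (nseq n (op u0)).
Proof.
rewrite op_cast; apply: (@eq_fcomp n x (fun=> op u0)) => i.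
by rewrite nth_nseq ltn_ord.
Qed.

Definition aug n (x : P n) : K := scalar0 (aug_op x).

Lemma aug_linear n : linear (@aug n : P n -> K^o).
Proof.
move=> a x y; rewrite /aug /aug_op op_comp_linearl cast_op_linear.
set v := cast_op _ _; set w := cast_op _ _.
by rewrite {1}(scalar0E v) {1}(scalar0E w) scalerA -scalerDl scalar0Z.
Qed.

HB.instance Definition _ n :=
  GRing.isLinear.Build K (P n) (com_space K n) _ (@aug n) (@aug_linear n).

Lemma op_scale m n (x : P m) (y : P n) c :
  op x = op y -> op (c *: x) = op (c *: y).
Proof.
move=> e; have mn : m = n by exact: (congr1 tag e).
by case: _ / mn y e => y /op_inj ->.
Qed.

Lemma aug_id : aug (op_id A) = 1.
Proof.
rewrite /aug (_ : aug_op _ = 1 *: u0) ?scalar0Z // scale1r.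
by apply: op_inj; rewrite op_aug_op scomp_id.
Qed.

(** Plugging u0 everywhere into theta(phi_1, ..., phi_n) replaces phi_i by
    aug phi_i *: u0; the scalars come out by multilinearity, leaving
    theta(u0, ..., u0). *)
Lemma aug_comp n (k : 'I_n -> nat) (theta : P n) (phi : forall i, P (k i)) :
  aug (op_comp A theta phi) = aug theta * \prod_i aug (phi i).
Proof.
rewrite /aug -[RHS]scalar0Z; congr scalar0; apply: op_inj.
rewrite op_cast.
transitivity (fcomp theta (fun i => op (aug (phi i) *: u0))).
  transitivity (fcomp theta (fun i => fcomp (phi i) (fun=> op u0))).
    by apply/esym/(op_compA A theta phi (fun i j => u0)).
  by apply: eq_fcomp => i; rewrite -scalar0E op_cast.
rewrite mulrC -scalerA -scalar0E.
transitivity (op ((\prod_i aug (phi i)) *: op_comp A theta (fun=> u0))).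
  by rewrite -op_comp_scale.
by apply: op_scale; rewrite op_cast.
Qed.

Lemma aug_del_first n (x : P n.+1) : aug (del_first x) = aug x.
Proof.
rewrite /aug; congr scalar0; apply: op_inj; rewrite !op_aug_op op_del_first.
pose ps := (op u0, [::]) :: nseq n (idop, [:: op u0]).
have := @scompA (op x) ps.
rewrite /= size_nseq all_nseq /= orbT /unzip1 /unzip2 !map_nseq.
rewrite scomp_u0 scomp_id => /(_ erefl erefl) <-.
have -> m : flatten (nseq m [:: op u0]) = nseq m (op u0).
  by elim: m => //= m ->.
by [].
Qed.

Lemma aug_surjective n : exists x : P n, aug x = 1.
Proof.
elim: n => [|n [x x1]]; last first.
  by exists (add_first x); rewrite -aug_del_first add_firstK.
exists u0; rewrite /aug (_ : aug_op _ = 1 *: u0) ?scalar0Z // scale1r.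
by apply: op_inj; rewrite op_aug_op scomp_u0.
Qed.

Lemma aug_injective :
  (forall n, injective (@del_first n)) -> forall n, injective (@aug n).
Proof.
move=> inj; elim=> [|n IH] x y; last by rewrite -!aug_del_first => /IH/inj.
rewrite /aug => e; suff aug0 (z : P 0%N) : aug_op z = z.
  by rewrite -(aug0 x) -(aug0 y) (scalar0E (aug_op x)) e -scalar0E.
by apply: op_inj; rewrite op_aug_op (scomp_ids (op z)).
Qed.

Lemma aug_bijective :
  (forall n, injective (@del_first n)) -> forall n, bijective (@aug n).
Proof.
move=> inj n; have [v v1] := aug_surjective n.
have augK c : aug (c *: v) = c.
  have -> := linearZ_LR (@aug n : {linear P n -> com_space K n}) c v.
  by rewrite /= v1; exact: mulr1.
exists (fun c => c *: v) => // x.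
by apply: (aug_injective inj); rewrite augK.
Qed.

Lemma aug_iso : (forall n, injective (@del_first n)) ->
  plain_operad_iso A (Com K) (fun n => @aug n : {linear P n -> com_space K n}).
Proof.
move=> inj; split; [exact: aug_bijective | exact: aug_id | exact: aug_comp].
Qed.

End Augmentation.
End TwoUnitary.
End Operad.

(** By equivariance, a permutation of the inputs of theta becomes a permutation
    of the inputs of theta(u0, ..., u0), which has none. *)
Lemma aug_act (K : fieldType) (P : nat -> lmodType K) (A : sym_operad P) u0
    (span0 : spans_arity0 u0) n (theta : P n) (s : 'S_n) :
  aug A span0 (op_act A theta s) = aug A span0 theta.
Proof.
rewrite /aug; congr scalar0; apply: op_inj; rewrite !op_cast.
apply: etrans (op_act_comp A theta (fun=> u0) s) _.
suff -> : block_perm (fun=> 0%N) s = 1%g by rewrite op_act1.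
apply/permP => i.
by have : (i < 0)%N by rewrite -[X in (_ < X)%N](aug_arity u0 n).
Qed.

(** * Quadratic growth and the Gelfand-Kirillov dimension *)

Lemma limn_esup_ge_frequently (R : realType) (u : nat -> \bar R) (l : \bar R) :
  (forall N, exists2 m, (N <= m)%N & (l <= u m)%E) -> (l <= limn_esup u)%E.
Proof.
move=> freq; rewrite limn_esup_lim; apply: lime_ge; first exact: is_cvg_esups.
apply: nearW => N; have [m Nm lm] := freq N.
by apply: (le_trans lm); apply: ereal_sup_ubound; exists m.
Qed.

(** The sum is at least 1 + ... + (n - k), and n - k >= n / 2. *)
Lemma quadratic_sum_bound (d : nat -> nat) (k n : nat) :
  (forall i, i <= d (k + i))%N -> (2 * k <= n)%N ->
  (n ^ 2 <= 8 * \sum_(i < n.+1) d i)%N.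
Proof.
move=> dge kn; have kn' : (k <= n)%N by clear dge; lia.
rewrite -(subnKC kn') in kn *; move: (n - k)%N kn => m kn.
rewrite -addnS big_split_ord /=.
have tri : (m ^ 2 <= 2 * \sum_(i < m.+1) d (k + i))%N.
  elim: (m) => [|j IH]; first by [].
  rewrite big_ord_recr /=.
  move: (\sum_(i < j.+1) _)%N IH (d _) (dge j.+1) => a IH b jb.
  by rewrite -mulnn in IH *; clear dge; nia.
move: tri; set a := (\sum_(i < k) _)%N; set b := (\sum_(i < m.+1) _)%N => tri.
have km : (k <= m)%N by clear dge; lia.
by rewrite -mulnn in tri *; clear dge; nia.
Qed.

(** ln (n^2 / 8) / ln n = 2 - ln 8 / ln n, and the error term is less than any
    positive e for large n. *)
Lemma log_ratio_limsup_ge2 (R : realType) (s : nat -> nat) (N0 : nat) :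
  (forall n, N0 <= n -> n ^ 2 <= 8 * s n)%N ->
  (2%:E <= limn_esup (fun n => (ln (s n)%:R / ln n%:R : R)%:E))%E.
Proof.
move=> sge; apply/lee_subgt0Pr => e e0; apply: limn_esup_ge_frequently => N.
have [m Nm [m1 mbig]] : exists2 m, (maxn N N0 <= m)%N &
    (1 < m)%N /\ expR (ln 8 / e) <= m%:R :> R.
  have /cvgryPge/(_ (expR (ln 8 / e)))[M _ MP] := @cvgr_idn R.
  exists (maxn (maxn N N0) (maxn 2 M)); first exact: leq_maxl.
  by split; [lia | apply: MP => /=; lia].
exists m; first by lia.
have m0 : 0 < m%:R :> R by rewrite ltr0n; lia.
have lnm0 : 0 < ln m%:R :> R by rewrite ln_gt0 // ltr1n.
have sm := sge m (leq_trans (leq_maxr _ _) Nm).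
have s0 : 0 < (s m)%:R :> R by rewrite ltr0n; nia.
rewrite -EFinB lee_fin ler_pdivlMr //.
have ln8 : ln 8 <= e * ln m%:R.
  rewrite mulrC -ler_pdivrMr // -[leLHS]expRK ler_ln ?posrE ?expR_gt0 //.
have : ln (m%:R ^+ 2) <= ln (8 * (s m)%:R) :> R.
  by rewrite ler_ln ?posrE ?mulr_gt0 ?exprn_gt0 // -natrX -natrM ler_nat.
by rewrite lnXn // lnM ?posrE //; lra.
Qed.

(** * Dimension growth and the theorem *)
Lemma scomp_pair (K : fieldType) (P : nat -> lmodType K) (A : plain_operad P)
    (u2 : P 2%N) m n (x : P m) (y : P n) :
  scomp A (op u2) [:: op x; op y] = op (op_comp A u2 (op_pair x y)).
Proof.
apply: (@eq_fcomp _ _ A _ u2 _ (fun i => op (op_pair x y i))).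
by case=> [[|[]]].
Qed.

Lemma dim_lt_split_epi (K : fieldType) (U V : vectType K) (D : {linear U -> V})
    (S : V -> U) (x : U) :
  cancel S D -> x != 0 -> D x = 0 -> (\dim {:V} < \dim {:U})%N.
Proof.
move=> SK x0 Dx; rewrite -(limg_ker_dim (linfun D) fullv) capfv.
have -> : (linfun D @: fullv)%VS = fullv.
  apply/eqP; rewrite eqEsubv subvf; apply/subvP => y _.
  have -> : y = linfun D (S y) by rewrite lfunE /= SK.
  exact/memv_img/memvf.
rewrite -[ltnLHS]add0n ltn_add2r lt0n dimv_eq0.
apply: contraNneq x0 => ker0; rewrite -memv0 -ker0 memv_ker lfunE /=.
exact/eqP.
Qed.

Section Growth.
Variables (K : fieldType) (P : nat -> vectType K).
Variables (A : plain_operad (lmod_of P)).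
Variables (u0 : lmod_of P 0%N) (u2 : lmod_of P 2%N).
Hypotheses (unitl : scomp A (op u2) [:: op u0; idop A] = idop A).
Hypotheses (unitr : scomp A (op u2) [:: idop A; op u0] = idop A).

Lemma dim_succ n (x : lmod_of P n.+1) : x != 0 -> del_first A u0 x = 0 ->
  (\dim {:P n} < \dim {:P n.+1})%N.
Proof.
exact: (@dim_lt_split_epi K (P n.+1) (P n)
  (del_first A u0 (n := n) : {linear lmod_of P n.+1 -> lmod_of P n})
  (@add_first _ _ A u2 n) x (add_firstK unitl (n := n))).
Qed.

(** Adding last inputs one at a time spreads a single kernel element of
    del_first to all higher arities. *)
Lemma dim_growth k (x : lmod_of P k.+1) : x != 0 -> del_first A u0 x = 0 ->
  forall i, (i <= \dim {:P (k + i)})%N.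
Proof.
move=> x0 dx.
have ker i : exists2 y : lmod_of P (k + i).+1, y != 0 & del_first A u0 y = 0.
  elim: i => [|i [y y0 dy]]; first by rewrite addn0; exists x.
  rewrite addnS; exists (add_last A u2 y); last first.
    by rewrite del_first_add_last // dy add_last0.
  apply: contraNneq y0 => y'0; rewrite -(add_lastK unitr y) y'0.
  by rewrite raddf0.
elim=> // i IH; rewrite addnS; have [y y0 dy] := ker i.
exact: leq_ltn_trans IH (dim_succ y0 dy).
Qed.

Lemma del_first_injective (R : realType) : (GKdim R P < 2%:E)%E ->
  forall n, injective (del_first A u0 (n := n)).
Proof.
move=> gk n; apply: raddf_inj => x dx.
apply/eqP/negPn/negP => x0; move: gk.
rewrite ltNge => /negP; apply.
apply: (@log_ratio_limsup_ge2 R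
  (fun m => \sum_(i < m.+1) \dim {:P i})%N (2 * n)) => m.
apply: (@quadratic_sum_bound (fun i => \dim {:P i}) n).
exact: dim_growth dx.
Qed.

End Growth.

Theorem proposition0p5 (R : realType) (K : fieldType) (P : nat -> vectType K) :
  (forall A : plain_operad (lmod_of P),
     two_unitary A -> (GKdim R P < 2%:E)%E ->
     plain_isomorphic A (Com K)) /\
  (forall A : sym_operad (lmod_of P),
     two_unitary A -> (GKdim R P < 2%:E)%E ->
     sym_isomorphic A (symCom K)).
Proof.
split=> A [u0 [span0 [u2 [unitl unitr]]]] gk.
all: have {}unitl : scomp A (op u2) [:: op u0; idop A] = idop A
  by rewrite scomp_pair.
all: have {}unitr : scomp A (op u2) [:: idop A; op u0] = idop A
  by rewrite scomp_pair.
all: have iso := aug_iso unitl span0 (del_first_injective unitl unitr gk).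
- by eexists; exact: iso.
- by eexists; [exact: iso | exact: aug_act].
Qed.
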